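(* Let $f(z)=z^2-2$, $g(z)=4z^2-2$ and let $G=\langle f,g\rangle$ be the polynomial semigroup generated by $f$ and $g$. Then $J(G)=[-2,2]=J_f$, while $J_g\subset[-1,1]$, so that $J_g\subsetneq J_f$ and in particular $J_f\neq J_g$. Moreover, $G$ is not nearly abelian.
   Context: $\overline{\mathbb{C}}$ is the Riemann sphere, with the spherical metric. A rational semigroup is a semigroup (under composition) of rational functions of degree at least two on $\overline{\mathbb{C}}$; $\langle f,g\rangle$ denotes the semigroup generated by $f$ and $g$. For a rational semigroup $G$, the set of normality $N(G)$ is the set of $z\in\overline{\mathbb{C}}$ having a neighborhood on which $G$ is a normal family, and the Julia set is $J(G)=\overline{\mathbb{C}}\setminus N(G)$. For a single rational map $h$ of degree at least two, $J_h=J(\langle h\rangle)$. A rational semigroup $G$ is nearly abelian if there is a compact family $\Phi$ of Möbius transformations such that (i) $\varphi(N(G))=N(G)$ for all $\varphi\in\Phi$, and (ii) for all $f,g\in G$ there is a $\varphi\in\Phi$ such that $f\circ g=\varphi\circ g\circ f$. *)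

(* Defs.v *)
From HB Require Import structures.
From mathcomp Require Import all_boot all_order all_algebra.
From mathcomp Require Import ring lra.
From mathcomp Require Import complex.
From mathcomp Require Import all_classical all_reals all_analysis.

Set Implicit Arguments.
Unset Strict Implicit.
Unset Printing Implicit Defensive.

Import Order.TTheory GRing.Theory Num.Theory.
Import ComplexField.Normc.

Local Open Scope classical_set_scope.
Local Open Scope complex_scope.
Local Open Scope ring_scope.

(* [None] is the point at infinity, [Some z] the finite point z. *)
Definition riemann_sphere (R : realType) : Type := option R[i].

Section spherical_metric.
Variable R : realType.
Local Notation C := R[i].
Local Notation S := (riemann_sphere R).

(* The chordal form of the spherical metric, i.e., the Euclidean distance of
   R^3 restricted to the unit sphere and read through the stereographic
   projection. If theta denotes the geodesic (great circle) distance, this is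
   2 sin(theta/2), so that both metrics define the same uniform structure. *)
Definition spherical_dist (x y : S) : R :=
  match x, y with
  | Some z, Some w =>
      2 * normc (z - w)
        / (Num.sqrt (1 + normc z ^+ 2) * Num.sqrt (1 + normc w ^+ 2))
  | Some z, None | None, Some z => 2 / Num.sqrt (1 + normc z ^+ 2)
  | None, None => 0
  end.

Let hom (x : S) : C * C := if x is Some z then (z, 1) else (1, 0).
Let cross (u v : C * C) : C := u.1 * v.2 - u.2 * v.1.
Let nrm (u : C * C) : R := normc u.1 ^+ 2 + normc u.2 ^+ 2.
Let herm (u v : C * C) : C := u.1 * v.1^* + u.2 * v.2^*.

Let normc_ge0 (z : C) : 0 <= normc z.
Proof. by case: z => a b; exact: sqrtr_ge0. Qed.

Let normc_sqr (z : C) : normc z ^+ 2 = complex.Re z ^+ 2 + complex.Im z ^+ 2.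
Proof. by case: z => a b /=; rewrite sqr_sqrtr// addr_ge0// sqr_ge0. Qed.

Let nrm_hom_gt0 (x : S) : 0 < nrm (hom x).
Proof.
case: x => [z|]; rewrite /nrm /= ?(expr0n, expr1n, sqrtr0, sqrtr1, addr0)//.
by rewrite ltr_wpDl// sqr_ge0.
Qed.

Let lagrange u v : normc (herm u v) ^+ 2 + normc (cross u v) ^+ 2 = nrm u * nrm v.
Proof.
case: u v => [[a b] [c d]] [[e f] [g h]].
rewrite /herm /cross /nrm !normc_sqr /=; ring.
Qed.

Let herm_le u v : normc (herm u v) <= Num.sqrt (nrm u) * Num.sqrt (nrm v).
Proof.
rewrite -sqrtrM; last by rewrite addr_ge0// sqr_ge0.
rewrite -lagrange -[leLHS]ger0_norm ?normc_ge0// -sqrtr_sqr.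
by rewrite ler_sqrt ?lerDl ?sqr_ge0// addr_ge0// sqr_ge0.
Qed.

Let cross_herm u v w :
  cross u w * (nrm v)%:C = cross u v * herm w v + cross v w * herm u v.
Proof.
case: u v w => [[a b] [c d]] [[e f] [g h]] [[k l] [m n]].
rewrite /herm /cross /nrm !normc_sqr /=.
by apply/eqP; rewrite eq_complex /=; apply/andP; split; apply/eqP; ring.
Qed.

Let spherical_distE x y : spherical_dist x y =
  2 * normc (cross (hom x) (hom y))
    / (Num.sqrt (nrm (hom x)) * Num.sqrt (nrm (hom y))).
Proof.
have nS (z : C) : nrm (hom (Some z)) = 1 + normc z ^+ 2.
  by rewrite /nrm [hom _]/= normc1 expr1n addrC.
have nN : nrm (hom None) = 1.
  by rewrite /nrm [hom _]/= normc1 normc0 expr1n expr0n addr0.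
case: x y => [z|] [w|]; rewrite ?(nS, nN).
- by rewrite /cross [hom _]/= ?[hom _]/= mulr1 mul1r.
- by rewrite /cross [hom _]/= ?[hom _]/= mulr0 mul1r sub0r normcN normc1 sqrtr1 !mulr1.
- by rewrite /cross [hom _]/= ?[hom _]/= mulr1 mul0r subr0 normc1 sqrtr1 mulr1 mul1r.
- by rewrite /cross [hom _]/= ?[hom _]/= mulr0 mul0r subr0 normc0 mulr0 mul0r.
Qed.

Let spherical_distxx x : spherical_dist x x = 0.
Proof. by case: x => [z|] //=; rewrite subrr normc0 mulr0 mul0r. Qed.

Let spherical_dist_eq0 x y : spherical_dist x y = 0 -> x = y.
Proof.
have sN (z : C) : Num.sqrt (1 + normc z ^+ 2) != 0.
  by rewrite sqrtr_eq0 -ltNge ltr_pwDl// sqr_ge0.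
case: x y => [z|] [w|] //= /eqP; rewrite ?mulf_eq0 ?invr_eq0 ?mulf_eq0.
- rewrite !(negbTE (sN _)) pnatr_eq0 !orbF /= => /eqP/eq0_normc/eqP.
  by rewrite subr_eq0 => /eqP ->.
- by rewrite (negbTE (sN _)) pnatr_eq0.
- by rewrite (negbTE (sN _)) pnatr_eq0.
Qed.

Let spherical_distC x y : spherical_dist x y = spherical_dist y x.
Proof.
case: x y => [z|] [w|] //=.
by rewrite -normcN opprB [Num.sqrt _ * _]mulrC.
Qed.

Let spherical_dist_triangle y x z :
  spherical_dist x z <= spherical_dist x y + spherical_dist y z.
Proof.
rewrite !spherical_distE.
set u := hom x; set v := hom y; set w := hom z.
have pos t : 0 < Num.sqrt (nrm (hom t)) by rewrite sqrtr_gt0.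
have key : normc (cross u w) * nrm v <=
    normc (cross u v) * (Num.sqrt (nrm w) * Num.sqrt (nrm v)) +
    normc (cross v w) * (Num.sqrt (nrm u) * Num.sqrt (nrm v)).
  have -> : normc (cross u w) * nrm v = normc (cross u w * (nrm v)%:C).
    rewrite normcM; congr (_ * _).
    rewrite /= expr0n addr0 sqrtr_sqr ger0_norm// ltW//; exact: nrm_hom_gt0.
  rewrite cross_herm (le_trans (le_normcD _ _))// !normcM lerD//;
  by rewrite ler_wpM2l// herm_le.
have nv : nrm v = Num.sqrt (nrm v) * Num.sqrt (nrm v).
  by rewrite -expr2 sqr_sqrtr// ltW// nrm_hom_gt0.
have : 0 < Num.sqrt (nrm w) by exact: pos.
have : 0 < Num.sqrt (nrm v) by exact: pos.
have : 0 < Num.sqrt (nrm u) by exact: pos.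
move: nv key.
move: (Num.sqrt (nrm u)) (Num.sqrt (nrm v)) (Num.sqrt (nrm w)) => a b c.
move=> ->; rewrite (mulrA _ b b) (mulrA _ c b) (mulrA _ a b) -mulrDl.
move=> + pu pv pw; rewrite ler_pM2r// => key.
rewrite -subr_ge0.
have -> : 2 * normc (cross u v) / (a * b) + 2 * normc (cross v w) / (b * c) -
    2 * normc (cross u w) / (a * c) =
    2 * (normc (cross u v) * c + normc (cross v w) * a - normc (cross u w) * b)
    / (a * b * c).
  by field; rewrite !gt_eqF.
by rewrite divr_ge0 ?mulr_ge0 ?subr_ge0 ?(ltW pu) ?(ltW pv) ?(ltW pw).
Qed.

HB.instance Definition _ := Choice.on S.
HB.instance Definition _ := Pointed.on S.
HB.instance Definition _ := @isMetric.Build R S spherical_dist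
  spherical_distxx spherical_dist_eq0 spherical_distC spherical_dist_triangle.

End spherical_metric.

Section rational_maps.
Variable R : realType.
Local Notation C := R[i].
Local Notation S := (riemann_sphere R).

Definition rat_degree (p q : {poly C}) : nat := (maxn (size p) (size q)).-1.

(* The self-map p/q of the sphere (meaningful for coprime p and q). At infinity
   its value is the quotient of the coefficients of degree [rat_degree p q]. *)
Definition ratmap (p q : {poly C}) (x : S) : S :=
  match x with
  | Some z => if q.[z] == 0 then None else Some (p.[z] / q.[z])
  | None => let d := rat_degree p q in
            if q`_d == 0 then None else Some (p`_d / q`_d)
  end.

Definition polymap (p : {poly C}) : S -> S := ratmap p 1.

Definition rational_of_degree (d : nat) (h : S -> S) : Prop :=
  exists p q, [/\ coprimep p q, rat_degree p q = d & h = ratmap p q].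

Definition mobius (phi : S -> S) : Prop :=
  exists a b c d : C, a * d - b * c != 0 /\
    phi = ratmap (a *: 'X + b%:P) (c *: 'X + d%:P).

Definition comp_closed (G : set (S -> S)) : Prop :=
  forall h k, G h -> G k -> G (h \o k).

Definition rational_semigroup (G : set (S -> S)) : Prop :=
  (forall h, G h -> exists2 d, (2 <= d)%N & rational_of_degree d h)
  /\ comp_closed G.

Definition semigroup_generated (A : set (S -> S)) : set (S -> S) :=
  smallest comp_closed A.

Lemma polymap_comp (p q : {poly C}) : (1 < size p)%N -> (1 < size q)%N ->
  polymap p \o polymap q = polymap (p \Po q).
Proof.
have inf (r : {poly C}) : (1 < size r)%N -> polymap r None = None.
  move=> r1; rewrite /polymap /ratmap /rat_degree size_poly1.
  rewrite (maxn_idPl (ltnW r1)) coef1.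
  by case: (size r) r1 => [|[|n]] // _ /=; rewrite eqxx.
move=> p1 q1; apply/funext => -[z|]; last first.
  rewrite -[LHS]/(polymap p (polymap q None)) !inf// -ltn_predRL size_comp_poly -?subn1.
  by rewrite muln_gt0 !subn_gt0 p1.
by rewrite /polymap /ratmap /= !hornerE !oner_eq0 !divr1 !hornerE oner_eq0 divr1 horner_comp.
Qed.

Lemma rational_semigroup_polynomial (A : set {poly C}) :
  (forall p, A p -> (2 < size p)%N) ->
  rational_semigroup (semigroup_generated (polymap @` A)).
Proof.
move=> A2; split; last first.
  by move=> h k Gh Gk B BA; apply: BA.1; [exact: Gh BA|exact: Gk BA].
pose P := [set h : S -> S | exists2 p : {poly C}, (2 < size p)%N & h = polymap p].
suff GP : semigroup_generated (polymap @` A) `<=` P.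
  move=> h /GP[p p2 ->]; exists (rat_degree p 1).
    by rewrite /rat_degree size_poly1 (maxn_idPl (ltnW (ltnW p2))) ltn_predRL.
  by exists p, 1; split => //; exact: coprimep1.
apply: smallest_sub; last by move=> _ [p /A2 p2 <-]; exists p.
move=> _ _ [p p2 ->] [q q2 ->]; exists (p \Po q); last first.
  by rewrite polymap_comp// ltnW.
rewrite -ltn_predRL size_comp_poly.
have := leq_mul (_ : 2 <= (size p).-1)%N (_ : 2 <= (size q).-1)%N.
by rewrite !ltn_predRL => /(_ p2 q2) /(leq_trans _); apply.
Qed.

End rational_maps.

Section julia_sets.
Variable R : realType.
Local Notation S := (riemann_sphere R).

Definition cvg_locally_uniformly (U : set S) (h : nat -> S -> S) (l : S -> S) :
  Prop := forall z, U z -> exists2 V, nbhs z V & {uniform V, h @ \oo --> l}.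

Definition normal_family (U : set S) (F : set (S -> S)) : Prop :=
  forall h : nat -> S -> S, (forall n, F (h n)) ->
  exists (s : nat -> nat) (l : S -> S),
    {homo s : m n / (m < n)%N} /\ cvg_locally_uniformly U (h \o s) l.

Definition normality_set (G : set (S -> S)) : set S :=
  [set z | exists2 U, open_nbhs z U & normal_family U G].

Definition julia (G : set (S -> S)) : set S := ~` normality_set G.

Definition julia_map (h : S -> S) : set S := julia (semigroup_generated [set h]).

(* Compactness is that of uniform convergence on the sphere for the spherical
   metric. *)
Definition nearly_abelian (G : set (S -> S)) : Prop :=
  exists Phi : set {uniform S -> S},
    [/\ compact Phi,
        forall phi, Phi phi -> mobius phi,
        forall phi : S -> S, Phi phi ->
          phi @` normality_set G = normality_set G &
        forall f g, G f -> G g ->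
          exists2 phi : S -> S, Phi phi & f \o g = phi \o g \o f].

Definition real_segment (a b : R) : set S :=
  [set Some x%:C | x in `[a, b]].

End julia_sets.

(* Main.v *)
(* With E(z) = (|z - 2| + |z + 2|) / 2, one has E(z^2 - 2) = E(z)^2 - 2 by the
   parallelogram law, E >= 2 with equality exactly on [-2,2], and E(z) <= E(2z).
   Since g(z) = f(2z), both generators therefore multiply E - 2 by at least 4,
   so that words of length n tend to infinity uniformly on {E >= 2 + d}; a
   sequence of words either has lengths tending to infinity or, by finiteness,
   repeats one word infinitely often, whence normality off [-2,2]. For g alone,
   z |-> E(2z) does the same off [-1,1].
   The last claim is purely algebraic: f o g = phi o (g o f) evaluated at 0 and 1
   gives phi(14) = 2 = phi(2), and Moebius maps are injective. *)
Require Import Defs.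
From mathcomp Require Import all_boot all_order all_algebra.
From mathcomp Require Import ring lra.
From mathcomp Require Import complex.
From mathcomp Require Import all_classical all_reals all_analysis.

Set Implicit Arguments.
Unset Strict Implicit.
Unset Printing Implicit Defensive.

Import Order.TTheory GRing.Theory Num.Theory.
Import ComplexField.Normc.

Local Open Scope classical_set_scope.
Local Open Scope complex_scope.
Local Open Scope ring_scope.

(** * Recurrence of a sequence and avoidance of finite sets *)

Section cardinality.

Lemma infinitely_often_increasing (P : nat -> Prop) :
  (forall m, exists2 k, (m < k)%N & P k) ->
  exists s : nat -> nat, {homo s : m n / (m < n)%N} /\ forall n, P (s n).
Proof.
move=> often.
have /choice[next /all_and2[nextl nextP]] :
    forall m, exists k, (m < k)%N /\ P k.
  by move=> m; have [k mk Pk] := often m; exists k.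
(* The exponent [n.+1] makes every term a value of [next]; the starting point 0 need not satisfy
   [P]. *)
exists (fun n => iter n.+1 next 0%N); split; last by move=> n; exact: nextP.
by apply: homo_ltn => [m n p|n]; [exact: ltn_trans|exact: nextl].
Qed.

Lemma eventually_notin_finite (T : Type) (u : nat -> T) (B : set T) :
  finite_set B ->
  (forall b, B b -> exists m, forall k, (m < k)%N -> u k <> b) ->
  exists m, forall k, (m < k)%N -> ~ B (u k).
Proof.
move=> Bfin Bev.
(* Outside [B] the bound takes the default value 0, so that choice applies to all of [T]. *)
have /choice[bound boundP] :
    forall b, exists m, B b -> forall k, (m < k)%N -> u k <> b.
  move=> b; have [/Bev[m um]|nBb] := pselect (B b); first by exists m.
  by exists 0%N.
have /finite_seqP[N NE] : finite_set (bound @` B) by exact: finite_image.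
exists (\max_(m <- N) m)%N => k Nk Bk.
apply: (boundP _ Bk k _ erefl); apply: leq_ltn_trans Nk.
have Nb : bound (u k) \in N by have : (bound @` B) (bound (u k)) by []; rewrite NE.
exact: leq_bigmax_seq.
Qed.

End cardinality.

Lemma cvg_uniform_ballP (R : numFieldType) (U : choiceType)
    (M : pseudoMetricType R) (V : set U) (h : nat -> U -> M) (l : U -> M) :
  {uniform V, h @ \oo --> l} <->
  forall e : R, 0 < e -> \forall n \near \oo, forall y, V y -> ball (l y) e (h n y).
Proof.
split=> [hl e e0|hl].
  have /hl : nbhs (l : {uniform` V -> M}) [set k : U -> M | forall y, V y -> ball (l y) e (k y)].
    apply/uniform_nbhs; exists [set xy | ball xy.1 e xy.2]; split => //.
    exact: entourage_ball (PosNum e0).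
  by [].
move=> P /uniform_nbhs[E [entE EP]].
move: entE; rewrite -entourage_ballE => -[e /= e0 eE].
have := hl e e0; apply: filterS => n hn.
by apply: EP => y Vy; apply: eE => /=; exact: hn.
Qed.

(** * The complex modulus *)

Section modulus.
Variable R : realType.
Implicit Types z w : R[i].

Lemma normc_ge0 z : 0 <= normc z.
Proof. by case: z => a b; exact: sqrtr_ge0. Qed.

Lemma sqr_normc_ReIm z : normc z ^+ 2 = complex.Re z ^+ 2 + complex.Im z ^+ 2.
Proof. by case: z => a b /=; rewrite sqr_sqrtr// addr_ge0// sqr_ge0. Qed.

Lemma normc_parallelogram z w :
  normc (z - w) ^+ 2 + normc (z + w) ^+ 2 = 2 * normc z ^+ 2 + 2 * normc w ^+ 2.
Proof. by rewrite !sqr_normc_ReIm; case: z w => [a b] [c d] /=; ring. Qed.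

Lemma normc_real (x : R) : normc x%:C = `|x|.
Proof. by rewrite /= expr0n addr0 sqrtr_sqr. Qed.

Lemma normc_nat (n : nat) : normc (n%:R : R[i]) = n%:R.
Proof. by rewrite -(rmorph_nat (real_complex R)) normc_real ger0_norm. Qed.

Lemma normc_subC z w : normc (z - w) = normc (w - z).
Proof. by rewrite -normcN opprB. Qed.

Lemma normc_le_Re z : `|complex.Re z| <= normc z.
Proof.
by case: z => a b /=; rewrite -sqrtr_sqr ler_wsqrtr// lerDl sqr_ge0.
Qed.

End modulus.

(** * Half the sum of the distances to the foci -2 and 2 *)

Section joukowski.
Variable R : realType.
Implicit Types z w : R[i].

(* On the ellipse z = w + 1/w, |w| = r, with foci -2 and 2, the value is
   r + 1/r; the map z^2 - 2 lifts to w^2, whence [focal_mean_sqr_sub2]. *)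
Definition focal_mean z : R := (normc (z - 2) + normc (z + 2)) / 2.

Lemma focal_mean_sqr_sub2 z : focal_mean (z ^+ 2 - 2) = focal_mean z ^+ 2 - 2.
Proof.
rewrite /focal_mean subrK.
have -> : z ^+ 2 - 2 - 2 = (z - 2) * (z + 2) by ring.
rewrite expr2 !normcM.
have := normc_parallelogram z 2; rewrite normc_nat.
move: (normc (z - 2)) (normc (z + 2)) (normc z) => p q n pq.
have -> : n * n = (p ^+ 2 + q ^+ 2 - 2 * 2 ^+ 2) / 2 by rewrite pq; field.
by field.
Qed.

(** Each of z - 2 and z + 2 is a combination of 2z - 2 and 2z + 2 with weights 3/4 and -1/4 in one
    order or the other. The absolute weights on each of the two points add up to 1, so summing the
    two triangle inequalities gives the bound. *)
Lemma focal_mean_double z : focal_mean z <= focal_mean (2 * z).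
Proof.
rewrite /focal_mean ler_pM2r ?invr_gt0//.
have h1 : 4 * normc (z - 2) <= 3 * normc (2 * z - 2) + normc (2 * z + 2).
  rewrite -!(normc_nat R) -!normcM.
  have -> : 4 * (z - 2) = 3 * (2 * z - 2) - (2 * z + 2) by ring.
  by rewrite (le_trans (le_normcD _ _))// normcN.
have h2 : 4 * normc (z + 2) <= normc (2 * z - 2) + 3 * normc (2 * z + 2).
  rewrite -!(normc_nat R) -!normcM.
  have -> : 4 * (z + 2) = - (2 * z - 2) + 3 * (2 * z + 2) by ring.
  by rewrite (le_trans (le_normcD _ _))// normcN.
lra.
Qed.

Lemma focal_mean_lip z w : focal_mean z <= focal_mean w + normc (z - w).
Proof.
have h c : normc (z + c) <= normc (w + c) + normc (z - w).
  have -> : z + c = (w + c) + (z - w) by ring.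
  exact: le_normcD.
have := h 2; have := h (-2); rewrite /focal_mean; lra.
Qed.

Lemma focal_mean_ge z : normc z <= focal_mean z.
Proof.
have := le_normcD (z + 2) (z - 2).
have -> : z + 2 + (z - 2) = 2 * z by ring.
by rewrite normcM normc_nat /focal_mean => ?; lra.
Qed.

Lemma focal_mean_le z : focal_mean z <= 2 + normc z.
Proof.
have := le_normcD z 2; have := le_normcD z (- 2).
by rewrite normcN normc_nat /focal_mean => ? ?; lra.
Qed.

Lemma focal_mean_le2 z : focal_mean z <= 2 -> exists2 x, -2 <= x <= 2 & z = x%:C.
Proof.
case: z => a b E2.
have pE := sqr_normc_ReIm (a +i* b - 2); have qE := sqr_normc_ReIm (a +i* b + 2).
have p2 := normc_le_Re (a +i* b - 2); have q2 := normc_le_Re (a +i* b + 2).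
have p0 := normc_ge0 (a +i* b - 2); have q0 := normc_ge0 (a +i* b + 2).
move: E2; rewrite /focal_mean; move: pE qE p2 q2 p0 q0.
move: (normc (a +i* b - 2)) (normc (a +i* b + 2)) => p q.
rewrite /= !ler_norml ?oppr0 ?addr0 => pE qE /andP[p1 p2] /andP[q1 q2] p0 q0 pq.
(* Here p >= 2 - a, q >= 2 + a and p + q <= 4, so both bounds are equalities; a distance equal to
   its real part leaves no imaginary part. *)
have ep : p = 2 - a by lra.
have b0 : b ^+ 2 = 0 by move: pE; rewrite ep; lra.
exists a; first lra.
by apply/eqP; rewrite eq_complex /= eqxx /= -sqrf_eq0 b0.
Qed.

End joukowski.

(** * Chordal distance against modulus *)

Section sphere.
Variable R : realType.
Local Notation S := (riemann_sphere R).
Implicit Types z w : R[i].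

Lemma ball_sphereE (x : S) (e : R) : ball x e = [set y | spherical_dist x y < e].
Proof. by rewrite ballEmdist. Qed.

Lemma spherical_distxx (x : S) : spherical_dist x x = 0.
Proof. exact: (@mdistxx R S). Qed.

Lemma spherical_dist_sym (x y : S) : spherical_dist x y = spherical_dist y x.
Proof. exact: (@metric_sym R S). Qed.

Lemma spherical_dist_triangle (x y z : S) :
  spherical_dist x z <= spherical_dist x y + spherical_dist y z.
Proof. exact: (@metric_triangle R S). Qed.

Lemma sqrtr1D_sqr_ge (t : R) : 0 <= t ->
  1 <= Num.sqrt (1 + t ^+ 2) /\ t <= Num.sqrt (1 + t ^+ 2).
Proof.
move=> t0; split.
  by rewrite -[leLHS]sqrtr1 ler_wsqrtr// lerDl sqr_ge0.
by rewrite -{1}(ger0_norm t0) -sqrtr_sqr ler_wsqrtr// lerDr.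
Qed.

Lemma sqrtr1D_sqr_le (t : R) : 0 <= t -> Num.sqrt (1 + t ^+ 2) <= 1 + t.
Proof.
move=> t0; rewrite -[leRHS]ger0_norm ?addr_ge0// -sqrtr_sqr ler_wsqrtr//.
by rewrite sqrrD expr1n mul1r lerD2r lerDl mulrn_wge0.
Qed.

Lemma spherical_dist_finite_le z w :
  spherical_dist (Some z) (Some w) <= 2 * normc (z - w).
Proof.
rewrite /= ler_pdivrMr; last first.
  by rewrite mulr_gt0// sqrtr_gt0 ltr_pwDl// sqr_ge0.
have [z1 _] := sqrtr1D_sqr_ge (normc_ge0 z).
have [w1 _] := sqrtr1D_sqr_ge (normc_ge0 w).
by rewrite ler_peMr ?mulr_ge0 ?normc_ge0// mulr_ege1.
Qed.

Lemma spherical_dist_infty_le z : 0 < normc z ->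
  spherical_dist (Some z) None <= 2 / normc z.
Proof.
move=> z0 /=; rewrite ler_pM2l// lef_pV2 ?posrE//; last first.
  by rewrite sqrtr_gt0 ltr_pwDl// sqr_ge0.
by have [] := sqrtr1D_sqr_ge (normc_ge0 z).
Qed.

Lemma spherical_dist_infty_ge z :
  2 / (1 + normc z) <= spherical_dist (Some z) None.
Proof.
have z0 := normc_ge0 z.
rewrite /= ler_pM2l// lef_pV2 ?posrE ?sqrtr1D_sqr_le// ?sqrtr_gt0.
  by rewrite ltr_pwDl.
by rewrite ltr_pwDl// sqr_ge0.
Qed.

Lemma nbhs_infty_normc (B : R) :
  nbhs (None : S) [set x | if x is Some z then B < normc z else True].
Proof.
have B0 : 0 < 1 + `|B| by rewrite ltr_pwDl.
apply/nbhs_ballP; exists (2 / (1 + `|B|)) => /=; first by rewrite divr_gt0.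
rewrite ball_sphereE => -[z|//]; rewrite /mkset spherical_dist_sym.
move/(le_lt_trans (spherical_dist_infty_ge z)).
rewrite ltr_pM2l// ltf_pV2 ?posrE//; last by rewrite ltr_pwDl// normc_ge0.
by rewrite ltrD2l; exact/le_lt_trans/ler_norm.
Qed.

Lemma nbhs_finite_normc z (e : R) : 0 < e ->
  nbhs (Some z : S) [set x | if x is Some w then normc (z - w) < e else False].
Proof.
move=> e0; set B := 1 + normc z.
have z0 := normc_ge0 z.
have B1 : 1 <= B by rewrite lerDl.
have B0 : 0 < B by lra.
have e' : 0 < e / (B + e) by rewrite divr_gt0// addr_gt0.
(* If |z - w| = t >= e, the two square roots are at most B and B + t, so the distance is at least 2t
   / (B (B + t)). This increases with t, and its value at t = e is the radius. Infinity is excluded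
   because its distance to z is at least 2 / B. *)
apply/nbhs_ballP; exists (2 / B * (e / (B + e))) => /=.
  by rewrite mulr_gt0// divr_gt0.
have zB := sqrtr1D_sqr_le z0.
have zp : 0 < Num.sqrt (1 + normc z ^+ 2).
  by rewrite sqrtr_gt0 ltr_pwDl// sqr_ge0.
rewrite ball_sphereE => -[w|]; rewrite /mkset; last first.
  rewrite ltNge => /negP; apply; apply: le_trans (spherical_dist_infty_ge z).
  rewrite ler_piMr// ?divr_ge0//; first by lra.
  by rewrite ler_pdivrMr; lra.
apply: contraTT; rewrite -!leNgt => ezw.
have t0 := normc_ge0 (z - w).
have w0 := normc_ge0 w.
have wB := sqrtr1D_sqr_le w0.
have wz : 1 + normc w <= B + normc (z - w).
  have := le_normcD z (w - z); rewrite addrC subrK (normc_subC z).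
  by rewrite /B; lra.
have wp : 0 < Num.sqrt (1 + normc w ^+ 2).
  by rewrite sqrtr_gt0 ltr_pwDl// sqr_ge0.
rewrite /= ler_pdivlMr ?mulr_gt0//.
have Be : 0 < B + e by rewrite addr_gt0.
apply: (@le_trans _ _ (2 / B * (e / (B + e)) * (B * (B + normc (z - w))))).
  apply: ler_wpM2l; first by rewrite mulr_ge0 ?divr_ge0// ltW.
  by apply: ler_pM; rewrite ?(ltW zp) ?(ltW wp)// (le_trans wB).
have -> : 2 / B * (e / (B + e)) * (B * (B + normc (z - w))) =
    2 * (e * (B + normc (z - w)) / (B + e)) by field; rewrite !gt_eqF.
rewrite ler_pM2l// ler_pdivrMr// [leLHS]mulrDr [leRHS]mulrDr lerD ?ler_pM2r//.
by rewrite mulrC.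
Qed.

End sphere.

(** * Words in the generators, and normality from uniform escape to infinity *)

Section fatou.
Variable R : realType.
Local Notation S := (riemann_sphere R).

Lemma comp_closed_semigroup_generated (A : set (S -> S)) :
  comp_closed (semigroup_generated A).
Proof. by move=> h k Gh Gk B BA; apply: BA.1; [exact: Gh BA|exact: Gk BA]. Qed.

Fixpoint words (A : set (S -> S)) (n : nat) : set (S -> S) :=
  if n is m.+1 then [set a \o k | a in A & k in words A m] else [set id].

Lemma words_comp (A : set (S -> S)) m n h k :
  words A m h -> words A n k -> words A (m + n) (h \o k).
Proof.
elim: m h => [h /= -> //|m IH h /= [a Aa [b mb <-]] nk].
by exists a => //; exists (b \o k) => //; exact: IH.
Qed.

Lemma finite_words (A : set (S -> S)) n : finite_set A -> finite_set (words A n).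
Proof.
by move=> Afin; elim: n => [|n IH] /=; [exact: finite_set1|exact: finite_image2].
Qed.

Lemma semigroup_generated_words (A : set (S -> S)) :
  semigroup_generated A `<=` \bigcup_n words A n.
Proof.
apply: smallest_sub => [h k [m _ mh] [n _ nk]|a Aa].
  by exists (m + n)%N => //; exact: words_comp.
by exists 1%N => //=; exists a => //; exists id.
Qed.

Lemma escape_rate (d e : R) : 0 < d -> 0 < e ->
  exists N, forall n, (N <= n)%N -> 4 / (4 ^+ n * d) < e.
Proof.
move=> d0 e0; exists (Num.bound (4 / d / e)) => n Nn.
have Nb : 4 / d / e < (Num.bound (4 / d / e))%:R.
  by apply: archi_boundP; rewrite !divr_ge0// ltW.
have N4 : (Num.bound (4 / d / e))%:R <= 4 ^+ n :> R.
  by rewrite -natrX ler_nat (leq_trans Nn)// ltnW// ltn_expl.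
rewrite ltr_pdivrMr; last by rewrite mulr_gt0// exprn_gt0.
have := lt_le_trans Nb N4; rewrite !ltr_pdivrMr// => /lt_le_trans; apply.
by rewrite [4 ^+ n * e]mulrC mulrA.
Qed.

(** [lev d] abstracts the set where the escape function exceeds its minimum by at least d; each
    generator multiplies d by 4, and 4 / d bounds the distance to infinity. *)
Lemma normality_escape (A : set (S -> S)) (lev : R -> set S) :
  finite_set A ->
  (forall a d x, A a -> 0 < d -> lev d x -> lev (4 * d) (a x)) ->
  (forall d x, 0 < d -> lev d x -> spherical_dist x None <= 4 / d) ->
  forall d z, 0 < d -> nbhs z (lev d) ->
    normality_set (semigroup_generated A) z.
Proof.
move=> Afin levA lev_dist d z d0 zd.
have lev_words n h x : words A n h -> lev d x -> lev (4 ^+ n * d) (h x).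
  move=> + dx; elim: n h => [h /= ->|n IH h /= [a Aa [k nk <-]]].
    by rewrite mul1r.
  rewrite exprS -mulrA; apply: (levA a _ (k x)) => //; first by rewrite mulr_gt0// exprn_gt0.
  exact: IH.
exists (lev d)^°; first by split => //; exact: open_interior.
move=> h Gh.
(* The dichotomy is on maps, not on words: a map taken infinitely often gives a constant
   subsequence; otherwise each map occurs only finitely often. *)
have [[b b_often]|no_b] :=
    pselect (exists b, forall m, exists2 k, (m < k)%N & h k = b).
  have [s [sinc sb]] := infinitely_often_increasing b_often.
  exists s, b; split => // y yd; exists (lev d) => //.
  apply/cvg_uniform_ballP => e e0; apply: nearW => n w _ /=.
  by rewrite sb; exact: ballxx.
exists id, (fun=> None); split => // y yd; exists (lev d) => //.
apply/cvg_uniform_ballP => e e0.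
have [N Nle] := escape_rate d0 e0.
(* Only finitely many maps are words of length below [N], so the sequence eventually leaves them
   all; from then on any word representing [h k] has length at least [N]. *)
have Nfin : finite_set (\bigcup_(n in `I_N) words A n).
  by apply: bigcup_finite => // n _; exact: finite_words.
have [|m hm] := eventually_notin_finite (u := h) Nfin.
  move=> b _; apply/not_existsP => nb; apply: no_b; exists b => m.
  have /existsNP[k] := nb m.
  by move=> /not_implyP[mk /contrapT hk]; exists k.
exists m.+1 => //= k mk w dw.
have [n _ nh] := semigroup_generated_words (Gh k).
have Nn : (N <= n)%N.
  by rewrite leqNgt; apply/negP => nN; apply: (hm k mk); exists n.
rewrite ball_sphereE /mkset spherical_dist_sym.
have d4 : 0 < 4 ^+ n * d by rewrite mulr_gt0// exprn_gt0.
apply: (le_lt_trans (lev_dist _ _ d4 (lev_words _ _ _ nh dw))).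
exact: Nle.
Qed.

End fatou.

(** * Expansion of the escape levels by the generators, and upper bounds for Julia sets *)

Section polynomial_dynamics.
Variable R : realType.
Local Notation S := (riemann_sphere R).
Implicit Types (z w : R[i]) (p : {poly R[i]}).

Lemma polymap_finite p z : polymap p (Some z) = Some p.[z].
Proof. by rewrite /polymap /= hornerC oner_eq0 divr1. Qed.

Lemma polymap_infty p : (1 < size p)%N -> polymap p None = None.
Proof.
move=> p1; rewrite /polymap /ratmap /rat_degree size_poly1.
rewrite (maxn_idPl (ltnW p1)) coef1.
by case: (size p) p1 => [|[|n]] // _ /=; rewrite eqxx.
Qed.

Lemma size_quadratic (a b : R[i]) : a != 0 -> (1 < size (a *: 'X^2 - b%:P)%R)%N.
Proof.
move=> a0; rewrite size_polyDl ?size_scale// ?size_polyXn// size_polyN.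
by rewrite (leq_ltn_trans (size_polyC_leq1 _)).
Qed.

(** The scale c shrinks the exceptional segment to [-2/c, 2/c]: c = 1 serves both generators
    together, c = 2 serves g alone. Infinity lies in every level. *)
Definition focal_level (c : R[i]) (d : R) : set S :=
  [set x | if x is Some z then 2 + d <= focal_mean (c * z) else True].

(** From 2 + d <= E(cz) <= 2 + |c||z| and |c| <= 2 follows |z| >= d/2, which is the origin of the
    constant 4. *)
Lemma focal_level_dist (c : R[i]) d x : normc c <= 2 -> 0 < d ->
  focal_level c d x -> spherical_dist x None <= 4 / d.
Proof.
move=> c2 d0; case: x => [z|_]; last first.
  by rewrite spherical_distxx divr_ge0// ltW.
rewrite /focal_level /mkset => /le_trans/(_ (focal_mean_le _)).
rewrite lerD2l normcM => dz.
have z0 := normc_ge0 z.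
have dz2 : d <= 2 * normc z by apply: le_trans dz _; rewrite ler_wpM2r.
have z_gt0 : 0 < normc z by lra.
apply: le_trans (spherical_dist_infty_le z_gt0) _.
by rewrite ler_pdivrMr// mulrAC ler_pdivlMr//; lra.
Qed.

Lemma focal_level_nbhs_infty (c : R[i]) : 1 <= normc c ->
  nbhs (None : S) (focal_level c 1).
Proof.
move=> c1; apply: filterS (nbhs_infty_normc 3) => -[z|//].
rewrite /focal_level /mkset => z3; apply: le_trans (focal_mean_ge _).
by rewrite normcM (le_trans (_ : _ <= normc z))// ?ler_peMl ?normc_ge0//; lra.
Qed.

Lemma focal_level_nbhs_finite (c : R[i]) z :
  normc c <= 2 -> 2 < focal_mean (c * z) ->
  nbhs (Some z : S) (focal_level c ((focal_mean (c * z) - 2) / 2)).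
Proof.
move=> c2 z2.
(* As |c| <= 2, moving z by less than a quarter of the excess E(cz) - 2 costs at most half of it. *)
have e0 : 0 < (focal_mean (c * z) - 2) / 4 by lra.
apply: filterS (nbhs_finite_normc z e0) => -[w|//].
rewrite /focal_level /mkset => zw.
have := focal_mean_lip (c * z) (c * w); rewrite -mulrBr normcM.
have : normc c * normc (z - w) <= 2 * normc (z - w).
  by rewrite ler_wpM2r// normc_ge0.
by lra.
Qed.

Lemma normality_focal (A : set (S -> S)) (c : R[i]) z :
  finite_set A -> 1 <= normc c <= 2 ->
  (forall a d x, A a -> 0 < d -> focal_level c d x -> focal_level c (4 * d) (a x)) ->
  2 < focal_mean (c * z) -> normality_set (semigroup_generated A) (Some z).
Proof.
move=> Afin /andP[c1 c2] levA z2.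
apply: (normality_escape Afin levA _ _ (focal_level_nbhs_finite c2 z2)).
  by move=> d x; exact: focal_level_dist.
by rewrite divr_gt0// subr_gt0.
Qed.

Lemma normality_focal_infty (A : set (S -> S)) (c : R[i]) :
  finite_set A -> 1 <= normc c <= 2 ->
  (forall a d x, A a -> 0 < d -> focal_level c d x -> focal_level c (4 * d) (a x)) ->
  normality_set (semigroup_generated A) None.
Proof.
move=> Afin /andP[c1 c2] levA.
apply: (normality_escape Afin levA _ _ (focal_level_nbhs_infty c1)) => //.
by move=> d x; exact: focal_level_dist.
Qed.

(** With t = 2 + s one has t^2 - 2 = 2 + 4s + s^2; the factor 4 is the multiplier at the fixed point
    2. *)
Lemma sqr_sub2_ge (d t : R) : 0 < d -> 2 + d <= t -> 2 + 4 * d <= t ^+ 2 - 2.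
Proof. by move=> d0 dt; have := sqr_ge0 (t - 2); nra. Qed.

Lemma horner_f z : ('X^2 - 2%:P).[z] = z ^+ 2 - 2.
Proof. by rewrite !hornerE. Qed.

Lemma horner_g z : (4 *: 'X^2 - 2%:P).[z] = (2 * z) ^+ 2 - 2.
Proof. by rewrite hornerD hornerN hornerC hornerZ hornerXn; ring. Qed.

Lemma polymap_f_infty : polymap ('X^2 - 2%:P) None = None :> S.
Proof. by rewrite polymap_infty// -[X in X - _]scale1r size_quadratic// oner_eq0. Qed.

Lemma polymap_g_infty : polymap (4 *: 'X^2 - 2%:P) None = None :> S.
Proof. by rewrite polymap_infty// size_quadratic// pnatr_eq0. Qed.

Lemma focal_level_f d (x : S) : 0 < d ->
  focal_level 1 d x -> focal_level 1 (4 * d) (polymap ('X^2 - 2%:P) x).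
Proof.
move=> d0; case: x => [z|]; last by rewrite polymap_f_infty.
rewrite polymap_finite horner_f /focal_level /mkset !mul1r focal_mean_sqr_sub2.
exact: sqr_sub2_ge.
Qed.

Lemma focal_level_g d (x : S) : 0 < d ->
  focal_level 1 d x -> focal_level 1 (4 * d) (polymap (4 *: 'X^2 - 2%:P) x).
Proof.
move=> d0; case: x => [z|]; last by rewrite polymap_g_infty.
rewrite polymap_finite horner_g /focal_level /mkset !mul1r focal_mean_sqr_sub2.
by move=> dz; apply: sqr_sub2_ge => //; apply: le_trans dz (focal_mean_double z).
Qed.

(** This combines E(2g(z)) >= E(g(z)) with E(g(z)) = E(2z)^2 - 2. *)
Lemma focal_level_double_g d (x : S) : 0 < d ->
  focal_level 2 d x -> focal_level 2 (4 * d) (polymap (4 *: 'X^2 - 2%:P) x).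
Proof.
move=> d0; case: x => [z|]; last by rewrite polymap_g_infty.
rewrite polymap_finite horner_g /focal_level /mkset => dz.
apply: le_trans (focal_mean_double _); rewrite focal_mean_sqr_sub2.
exact: sqr_sub2_ge.
Qed.

Lemma julia_sub_segment (A : set (S -> S)) (c : R) :
  finite_set A -> 1 <= c <= 2 ->
  (forall a d x, A a -> 0 < d ->
    focal_level c%:C d x -> focal_level c%:C (4 * d) (a x)) ->
  julia (semigroup_generated A) `<=` real_segment (- (2 / c)) (2 / c).
Proof.
move=> Afin c12 levA.
have nc : normc c%:C = c by rewrite normc_real ger0_norm//; lra.
have c0 : 0 < c by lra.
case=> [z|]; last first.
  by move=> []; apply: (normality_focal_infty (c := c%:C)); rewrite ?nc.
move=> zJ; have : focal_mean (c%:C * z) <= 2.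
  rewrite leNgt; apply/negP => cz.
  by apply: zJ; apply: (normality_focal (c := c%:C)); rewrite ?nc.
move=> /focal_mean_le2[x x2 zx]; exists (x / c).
  by rewrite /= in_itv/= -mulNr !ler_pM2r ?invr_gt0.
have c0' : c%:C != 0 by rewrite -(rmorph0 (real_complex R)) (inj_eq (@complexI R)) gt_eqF.
by congr Some; apply: (mulfI c0'); rewrite zx -rmorphM mulrC mulrVK// unitfE gt_eqF.
Qed.

End polynomial_dynamics.

(** * Non-normality of the iterates of f on [-2,2] *)

Section julia_of_chebyshev.
Variable R : realType.
Local Notation S := (riemann_sphere R).
Implicit Types z w : R[i].

Lemma nbhs_sphere_normc (V : set S) z : nbhs (Some z : S) V ->
  exists2 e : R, 0 < e & forall w, normc (z - w) < e -> V (Some w).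
Proof.
move=> /nbhs_ballP[e /= e0 eV]; exists (e / 2); first by rewrite divr_gt0.
move=> w zw; apply: eV; rewrite ball_sphereE /mkset.
by apply: (le_lt_trans (spherical_dist_finite_le z w)); lra.
Qed.

Let F z := z ^+ 2 - 2.
Let f : S -> S := polymap ('X^2 - 2%:P).

Let iter_f n z : iter n f (Some z) = Some (iter n F z).
Proof. by elim: n => //= n ->; rewrite /f polymap_finite horner_f. Qed.

Let iter_F_cont n z (e : R) : 0 < e ->
  exists2 d, 0 < d & forall w, normc (z - w) < d -> normc (iter n F z - iter n F w) < e.
Proof.
elim: n e => [|n IH] e e0; first by exists e.
set u := iter n F z; have u0 : 0 < 2 * normc u + 1 by have := normc_ge0 u; lra.
(* In F(u) - F(v) = (u - v)(u + v), the bound 1 on |u - v| gives |u + v| <= 2|u| + 1, and the second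
   bound then yields e. *)
have e'0 : 0 < Num.min 1 (e / (2 * normc u + 1)).
  by rewrite lt_min ltr01 divr_gt0.
have [d d0 dP] := IH _ e'0; exists d => // w /dP; rewrite /= -/u.
set v := iter n F w; rewrite lt_min => /andP[uv1 uve].
have -> : F u - F v = (u - v) * (u + v) by rewrite /F; ring.
rewrite normcM.
have uv : normc (u + v) <= 2 * normc u + 1.
  have -> : u + v = u + u - (u - v) by ring.
  have := le_normcD (u + u) (- (u - v)); have := le_normcD u u.
  by rewrite normcN; lra.
apply: (@le_lt_trans _ _ (normc (u - v) * (2 * normc u + 1))).
  by rewrite ler_wpM2l// normc_ge0.
by rewrite -ltr_pdivlMr.
Qed.

Let iter_F_real n (x : R) : -2 <= x <= 2 -> normc (iter n F x%:C) <= 2.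
Proof.
(* The induction needs the iterates to be real: z^2 - 2 does not preserve the disc of radius 2. *)
move=> x2; suff [y y2 ->] : exists2 y : R, -2 <= y <= 2 & iter n F x%:C = y%:C.
  by rewrite normc_real ler_norml.
elim: n => [|n [y y2 /= ->]]; first by exists x.
exists (y ^+ 2 - 2); first by nra.
by rewrite /F rmorphB rmorphXn rmorph_nat.
Qed.

Let focal_level_iter n d (x : S) : 0 < d ->
  focal_level 1 d x -> focal_level 1 (4 ^+ n * d) (iter n f x).
Proof.
move=> d0 dx; elim: n => [|n IH]; first by rewrite mul1r.
by rewrite exprS -mulrA; apply: focal_level_f => //; rewrite mulr_gt0// exprn_gt0.
Qed.

Lemma semigroup_generated_iter (h : S -> S) n :
  semigroup_generated [set h] (iter n.+1 h).
Proof.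
have hh : semigroup_generated [set h] h by exact: sub_gen_smallest.
by elim: n => // n IH; exact: (comp_closed_semigroup_generated hh IH).
Qed.

Lemma increasing_ge_id (s : nat -> nat) :
  {homo s : m n / (m < n)%N} -> forall n, (n <= s n)%N.
Proof.
by move=> sinc; elim=> // n IH; apply: leq_ltn_trans IH _; exact: sinc.
Qed.

(* The iterates stay in [-2,2] at x but tend to infinity at the points x + it,
   t > 0, so no limit of a subsequence is continuous at x. *)
Lemma segment_sub_julia_f : real_segment (-2) 2 `<=` julia_map f.
Proof.
move=> _ [x /= + <-]; rewrite in_itv/= => x2 [U [_ Ux] normU].
(* The shift [n.+1] skips the identity, which is not a generated map. *)
have [n|s [l [sinc /(_ _ Ux)[V Vx /cvg_uniform_ballP Vl]]]] :=
  normU (fun n => iter n.+1 f).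
  exact: semigroup_generated_iter.
(* The image of x stays at distance at least 2/3 from infinity, whereas a path through y, its limit
   value and a late iterate has length below 2/10 + 3/10 = 1/2. *)
have e0 : 0 < 10^-1 :> R by [].
have [N _ Nl] := Vl _ e0.
have [r r0 rV] := nbhs_sphere_normc Vx.
have [d d0 dF] := iter_F_cont (s N).+1 x%:C e0.
(* This puts y both in [V] and within the continuity radius of the iterate of index [s N]. *)
pose t := Num.min r d / 2.
have t0 : 0 < t by rewrite divr_gt0// lt_min r0.
have [tr td] : t < r /\ t < d.
  have : Num.min r d <= r /\ Num.min r d <= d by rewrite !ge_min !lexx orbT.
  by move: t0; rewrite /t; lra.
pose y := x +i* t.
have xy : normc (x%:C - y) = t.
  by rewrite /= subrr expr0n sub0r sqrrN add0r sqrtr_sqr ger0_norm// ltW.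
have Vy : V (Some y) by apply: rV; rewrite xy.
have y2 : 0 < focal_mean (1 * y) - 2.
  rewrite mul1r subr_gt0 ltNge; apply/negP => /focal_mean_le2[u _ [_ ty]].
  by rewrite ty ltxx in t0.
have [M Mle] := escape_rate y2 e0.
pose k := maxn M N.
have lk := Nl k (leq_maxr _ _) _ Vy.
have lN := Nl N (leqnn _) _ Vy.
have yk : spherical_dist (iter (s k).+1 f (Some y)) None < 10^-1.
  have y2lev : focal_level 1 (focal_mean (1 * y) - 2) (Some y : S).
    by rewrite /focal_level /mkset addrC subrK.
  have := focal_level_iter (s k).+1 y2 y2lev.
  move/(focal_level_dist _ _)/le_lt_trans; apply.
  - by rewrite normc1; lra.
  - by rewrite mulr_gt0// exprn_gt0.
  - apply: Mle; apply: leq_trans (leq_maxl _ _) _; apply: leq_trans (leqnSn _).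
    exact: increasing_ge_id.
have xyN : spherical_dist (iter (s N).+1 f (Some x%:C)) (iter (s N).+1 f (Some y)) < 2 / 10.
  rewrite !iter_f; apply: (le_lt_trans (spherical_dist_finite_le _ _)).
  by rewrite ltr_pM2l//; apply: dF; rewrite xy.
have xN : 2 / 3 <= spherical_dist (iter (s N).+1 f (Some x%:C)) None.
  rewrite iter_f; apply: le_trans (spherical_dist_infty_ge _).
  rewrite ler_pM2l// lef_pV2 ?posrE//.
    by have := iter_F_real (s N).+1 x2; lra.
  by rewrite ltr_pwDl// normc_ge0.
rewrite !ball_sphereE /mkset /= in lk lN.
rewrite -!iterS in lk lN.
have := spherical_dist_triangle (iter (s N).+1 f (Some x%:C)) (iter (s N).+1 f (Some y)) None.
have := spherical_dist_triangle (iter (s N).+1 f (Some y)) (l (Some y)) None.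
have := spherical_dist_triangle (l (Some y)) (iter (s k).+1 f (Some y)) None.
rewrite spherical_dist_sym in lN.
lra.
Qed.

End julia_of_chebyshev.

(** * Monotonicity of Julia sets, injectivity of Möbius maps, and the conclusion *)

Lemma julia_subset (R : realType) (A B : set (riemann_sphere R -> riemann_sphere R)) :
  A `<=` B -> julia (semigroup_generated A) `<=` julia (semigroup_generated B).
Proof.
move=> AB; apply: subsetC => z [U Uz UB]; exists U => // h hA; apply: UB => n.
exact: (sub_smallest2r (@comp_closed_semigroup_generated _ _) AB (hA n)).
Qed.

Lemma mobius_inj (R : realType) (phi : riemann_sphere R -> riemann_sphere R) (z w u : R[i]) :
  mobius phi -> phi (Some z) = Some u -> phi (Some w) = Some u -> z = w.
Proof.
move=> [a [b [c [d [abcd ->]]]]]; rewrite /ratmap !hornerE.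
case: eqP => // /eqP cz [zu]; case: eqP => // /eqP cw [wu].
have {}zu : a * z + b = u * (c * z + d) by rewrite -zu mulfVK.
have {}wu : a * w + b = u * (c * w + d) by rewrite -wu mulfVK.
apply/eqP; rewrite -subr_eq0; move: abcd; apply: contraNT => zw.
(* Two distinct points with the same finite value u would make the numerator u times the
   denominator, so that the determinant vanishes. *)
have au : a = u * c.
  apply: (mulIf zw).
  have -> : a * (z - w) = (a * z + b) - (a * w + b) by ring.
  by rewrite zu wu; ring.
have bu : b = u * d.
  have -> : b = (a * z + b) - a * z by ring.
  by rewrite zu au; ring.
by rewrite au bu; apply/eqP; ring.
Qed.

Unset Implicit Arguments.

Theorem mainTheorem2 (R : realType) :
  let f : riemann_sphere R -> riemann_sphere R := polymap ('X^2 - 2%:P) in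
  let g : riemann_sphere R -> riemann_sphere R := polymap (4 *: 'X^2 - 2%:P) in
  let G := semigroup_generated [set f; g] in
  julia G = real_segment (-2) 2 /\
  real_segment (-2) 2 = julia_map f /\
  julia_map g `<=` real_segment (-1) 1 /\
  julia_map g `<` julia_map f /\
  julia_map f <> julia_map g /\
  ~ nearly_abelian G.
Proof.
move=> f g G.
(* The equalities come from the cycle of inclusions of [-2,2] in J_f, of J_f in J(G) and of J(G) in
   [-2,2]. *)
have segf : real_segment (-2) 2 `<=` julia_map f := @segment_sub_julia_f R.
have fG : julia_map f `<=` julia G by apply: julia_subset => h ->; left.
have Gseg : julia G `<=` real_segment (-2) 2.
  have := @julia_sub_segment R [set f; g] 1; rewrite divr1; apply.
  - exact: finite_set2.
  - by rewrite lexx ler1n.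
  - by move=> a d x [->|->]; [exact: focal_level_f|exact: focal_level_g].
have gseg : julia_map g `<=` real_segment (-1) 1.
  have := @julia_sub_segment R [set g] 2; rewrite divff ?pnatr_eq0//; apply.
  - exact: finite_set1.
  - by rewrite lexx ler1n.
  - by move=> a d x ->; rewrite rmorph_nat; exact: focal_level_double_g.
have Geq : julia G = real_segment (-2) 2.
  by apply/seteqP; split => // z /segf/fG.
have feq : real_segment (-2) 2 = julia_map f.
  by apply/seteqP; split => // z /fG/Gseg.
have gf : julia_map g `<` julia_map f.
  rewrite -feq; split => [z /gseg[x /= x1 <-]|fg].
    by exists x => //=; move: x1; rewrite !in_itv/=; lra.
  (* The fixed point 2 of f witnesses strictness, since it lies outside [-1,1]. *)
  have : real_segment (-2) 2 (Some (2 : R)%:C) by exists 2 => //=; rewrite in_itv/=; lra.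
  by move=> /fg/gseg[x /= + [x2]]; rewrite x2 in_itv/=; lra.
split=> //; split=> //; split=> //; split=> //; split.
  by move=> fg; move: gf; rewrite fg => -[_]; apply.
case=> Phi [_ Phi_mobius _ Phi_comm].
have [||phi /Phi_mobius mphi fg] := Phi_comm f g.
- by apply: sub_gen_smallest; left.
- by apply: sub_gen_smallest; right.
have fgE (z : R[i]) : phi (Some ((2 * (z ^+ 2 - 2)) ^+ 2 - 2)) =
    Some (((2 * z) ^+ 2 - 2) ^+ 2 - 2).
  have : f (g (Some z)) = phi (g (f (Some z))) := congr1 (@^~ (Some z)) fg.
  by rewrite /f /g !polymap_finite !(horner_f, horner_g).
have f0 : phi (Some 14) = Some 2.
  by have := fgE 0; congr (phi (Some _) = Some _); ring.
have f1 : phi (Some 2) = Some 2.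
  by have := fgE 1; congr (phi (Some _) = Some _); ring.
have /eqP := mobius_inj mphi f0 f1.
by rewrite eqr_nat.
Qed.
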